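(* Let $m$ be a positive integer and let $G$ be a graph with $m$ edges and no isolated vertices. Then: (i) If $r\geq 2$, $m\geq 16r^2$ and $G$ contains no subgraph isomorphic to $K_{2,r+1}$, then $\rho(G)\leq\sqrt{m}$, with equality if and only if $G$ is a star (i.e. $G\cong K_{1,m}$). (ii) If $m\geq 9$ and $G$ contains no subgraph isomorphic to $C_3^+$ and no subgraph isomorphic to $C_4^+$, then $\rho(G)\leq\sqrt{m}$, with equality if and only if $G$ is a complete bipartite graph or $G$ is isomorphic to one of $S_7^3$, $S_8^2$, $S_9^1$.
   Context: $\rho(G)$ denotes the spectral radius (largest eigenvalue) of the adjacency matrix of $G$. ''Contains $F$'' means contains a (not necessarily induced) subgraph isomorphic to $F$. $C_t^+$ denotes the graph obtained from a cycle $C_t$ and a triangle $C_3$ by identifying an edge of one with an edge of the other. $S_n^k$ denotes the graph obtained from the star $K_{1,n-1}$ by adding $k$ pairwise disjoint edges among its $n-1$ leaves. *)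

(* Defs.v *)
From HB Require Import structures.
From mathcomp Require Import all_boot all_order all_algebra.
From mathcomp Require Import all_classical all_reals.

Set Implicit Arguments.
Unset Strict Implicit.
Unset Printing Implicit Defensive.

Import Order.TTheory GRing.Theory Num.Theory.

Local Open Scope ring_scope.

Record sgraph := SGraph {
  vertex :> finType;
  adj : rel vertex;
  adj_sym : symmetric adj;
  adj_irr : irreflexive adj }.

Definition edges (G : sgraph) : {set {set G}} :=
  [set E : {set G} | [exists x, exists y, adj x y && (E == [set x; y]%SET)]].

Definition no_isolated (G : sgraph) : Prop :=
  forall x : G, exists y : G, adj x y.

Definition isomorphic (G H : sgraph) : Prop :=
  exists2 f : G -> H, bijective f & forall x y, adj (f x) (f y) = adj x y.

(* The subgraph need not be induced: only the edges of F have to be preserved. *)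
Definition contains (G F : sgraph) : Prop :=
  exists2 f : F -> G, injective f & forall x y, adj x y -> adj (f x) (f y).

Definition adjacency (R : realType) (G : sgraph) : 'M[R]_#|G| :=
  \matrix_(i, j) (adj (enum_val i) (enum_val j))%:R.

(* The adjacency matrix is real symmetric, so when G has a vertex its set of
   real eigenvalues is finite and nonempty, and sup is its largest element. *)
Definition spectral_radius (R : realType) (G : sgraph) : R :=
  sup [set a : R | eigenvalue (adjacency R G) a]%classic.

Local Open Scope nat_scope.

Definition Kbip_adj (s t : nat) : rel ('I_s + 'I_t) :=
  fun x y => match x, y with
             | inl _, inr _ | inr _, inl _ => true
             | _, _ => false
             end.

Lemma Kbip_sym s t : symmetric (@Kbip_adj s t).
Proof. by move=> [x|x] [y|y]. Qed.

Lemma Kbip_irr s t : irreflexive (@Kbip_adj s t).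
Proof. by move=> [x|x]. Qed.

Definition Kbip (s t : nat) : sgraph := SGraph (@Kbip_sym s t) (@Kbip_irr s t).

Definition complete_bipartite (G : sgraph) : Prop :=
  exists s t : nat, [/\ 0 < s, 0 < t & isomorphic G (Kbip s t)].

(* C_t^+ for 3 <= t: the vertices [Some i] form the cycle C_t, and [None] is
   the third vertex of the triangle glued along the cycle edge {0, 1}. *)
Definition Cplus_adj (t : nat) : rel (option 'I_t) :=
  fun x y => match x, y with
             | Some i, Some j =>
                 (i != j) && ((i.+1 %% t == j) || (j.+1 %% t == i))
             | Some i, None | None, Some i => i < 2
             | None, None => false
             end.

Lemma Cplus_sym t : symmetric (@Cplus_adj t).
Proof. by move=> [i|] [j|] //=; rewrite eq_sym orbC. Qed.

Lemma Cplus_irr t : irreflexive (@Cplus_adj t).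
Proof. by move=> [i|] //=; rewrite eqxx. Qed.

Definition Cplus (t : nat) : sgraph := SGraph (@Cplus_sym t) (@Cplus_irr t).

(* S_n^k for 2 * k <= n - 1: the centre is 0, the leaves are 1, ..., n - 1, and
   the added edges are {2 * l + 1, 2 * l + 2} for l < k. *)
Definition Splus_adj (n k : nat) : rel 'I_n :=
  fun i j => (i != j) &&
    [|| val i == 0, val j == 0 | (i.-1./2 == j.-1./2) && (i.-1./2 < k)].

Lemma Splus_sym n k : symmetric (@Splus_adj n k).
Proof.
move=> i j; rewrite /Splus_adj eq_sym orbCA [i.-1./2 == _]eq_sym.
by case: (j.-1./2 =P i.-1./2) => [->|].
Qed.

Lemma Splus_irr n k : irreflexive (@Splus_adj n k).
Proof. by move=> i; rewrite /Splus_adj eqxx. Qed.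

Definition Splus (n k : nat) : sgraph :=
  SGraph (@Splus_sym n k) (@Splus_irr n k).

(* Main.v *)
Require Import Defs.
From mathcomp Require Import all_boot all_order all_algebra.
From mathcomp Require Import all_classical all_reals.
From mathcomp Require Import ring lra zify.
From mathcomp.real_closed Require Import polyrcf.

(* If [a] is an eigenvalue with eigenvector [v], then [y = |v| / max |v|]
   satisfies [a y <= A y] entrywise and [y u = 1] at some vertex [u]; no
   Perron-Frobenius theory is needed, since both bounds follow from evaluating
   [a^2 y <= A^2 y] at [u] and comparing with the number of edges [m] counted
   from [u].

   (i) Let [D = deg u] and let [M] be the largest entry of [y] off [u]. Then
   [a^2 <= D + 2 (m - D) M], while [K_{2,r+1}]-freeness, which bounds the
   off-diagonal entries of [A^2] by [r], forces [M < 1/2]. So [a^2 >= m] leaves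
   no edge off [u].

   (ii) The neighbours of [u] induce a matching, and a vertex [z] at distance two
   that is adjacent to a matched neighbour has no other neighbour in [N(u)].
   If [a^2 >= m >= 9], summing [a y <= A y] over the matched neighbours turns the
   deficit [a^2 - m] into a sum, over the vertices outside [N[u]], of terms which
   are nonnegative because [a >= 3]. Hence they all vanish: the outside is
   independent, carries [y = 1] and misses the matched vertices. Without
   triangles at [u] this is a complete bipartite graph; otherwise [a = 3],
   [m = 9], and the outside is empty. *)

Set Implicit Arguments.
Unset Strict Implicit.
Unset Printing Implicit Defensive.

Import Order.TTheory GRing.Theory Num.Theory.

Local Open Scope ring_scope.

(** * The spectral radius as a largest eigenvalue *)

Lemma seq_has_max (R : realDomainType) (s : seq R) (x0 : R) :
  x0 \in s -> exists2 b, b \in s & {in s, forall x, x <= b}.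
Proof.
elim: s x0 => // a [|a' s] IHs x0 _.
  by exists a => [|x]; rewrite inE // => /eqP->.
have [b bs b_max] := IHs a' (mem_head _ _).
have [le_ab|lt_ba] := leP a b.
  exists b => [|x]; rewrite inE ?bs ?orbT // => /orP[/eqP->//|]; exact: b_max.
exists a => [|x]; rewrite inE ?eqxx // => /orP[/eqP->//|/b_max le_xb].
exact: le_trans le_xb (ltW lt_ba).
Qed.

(** The eigenvalues are the roots of the characteristic polynomial, a finite list, so the supremum
    defining the spectral radius is attained as soon as one eigenvalue exists. *)
Lemma eigenvalue_max (R : rcfType) (n : nat) (A : 'M[R]_n) (a : R) :
  eigenvalue A a ->
  exists2 b, eigenvalue A b & forall c, eigenvalue A c -> c <= b.
Proof.
have rootsE c : eigenvalue A c = (c \in rootsR (char_poly A)).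
  rewrite eigenvalue_root_char -roots_on_rootsR ?inE //.
  exact: monic_neq0 (char_poly_monic A).
rewrite rootsE => /seq_has_max[b bA b_max].
by exists b => [|c]; rewrite rootsE //; exact: b_max.
Qed.

Lemma spectral_radius_le (R : realType) (G : sgraph) (b : R) :
  0 <= b -> (forall a, eigenvalue (adjacency R G) a -> a <= b) ->
  spectral_radius R G <= b.
Proof.
move=> b_ge0 b_max; rewrite /spectral_radius.
set S := [set a | _]%classic.
have [->|S0] := eqVneq S set0; first by rewrite sup0.
by apply: ge_sup => //; apply/set0P.
Qed.

(** A graph with no vertex has no eigenvalue, and then [sup] takes the default value 0; a nonzero
    radius excludes this case. *)
Lemma spectral_radius_eigenvalue (R : realType) (G : sgraph) :
  spectral_radius R G != 0 ->
  eigenvalue (adjacency R G) (spectral_radius R G).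
Proof.
rewrite {1}/spectral_radius; set S := [set a | _]%classic.
have [->|/set0P[a /eigenvalue_max[b bA b_max]]] := eqVneq S set0.
  by rewrite sup0 eqxx.
move=> _; suff -> : spectral_radius R G = b by [].
apply/eqP; rewrite eq_le ge_sup //=; last by exists b.
by apply: sup_upper_bound => //; split; exists b.
Qed.

Lemma eigenvalue_le_spectral_radius (R : realType) (G : sgraph) (a : R) :
  eigenvalue (adjacency R G) a -> a <= spectral_radius R G.
Proof.
move=> aA; have [b bA b_max] := eigenvalue_max aA.
by apply: sup_upper_bound => //; split; [exists b | exists b].
Qed.

(** * Eigenvectors as functions on the vertices *)

Lemma adjacency_mulE (R : realType) (G : sgraph) (v : 'rV[R]_#|G|) (x : G) :
  (v *m adjacency R G) 0 (enum_rank x)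
    = \sum_z (adj x z)%:R * v 0 (enum_rank z).
Proof.
rewrite mxE (reindex (@enum_rank G)) /=; last exact/onW_bij/enum_rank_bij.
by apply: eq_bigr => z _; rewrite mxE !enum_rankK mulrC adj_sym.
Qed.

Lemma eigenvalue_adjacency (R : realType) (G : sgraph) (a : R)
    (y : G -> R) (x0 : G) :
  y x0 != 0 -> (forall x, \sum_z (adj x z)%:R * y z = a * y x) ->
  eigenvalue (adjacency R G) a.
Proof.
move=> y0 yE; apply/eigenvalueP; exists (\row_i y (enum_val i)).
  apply/rowP => i; rewrite -[i]enum_valK adjacency_mulE !mxE enum_rankK -yE.
  by apply: eq_bigr => z _; rewrite mxE enum_rankK.
by apply/eqP => /rowP/(_ (enum_rank x0)); rewrite !mxE enum_rankK; exact/eqP.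
Qed.

Definition subeigen (R : realFieldType) (G : sgraph) (a : R) (y : G -> R)
    (u : G) :=
  [/\ forall x, 0 <= y x <= 1, y u = 1
    & forall x, a * y x <= \sum_z (adj x z)%:R * y z].

Lemma eigenvalue_subeigen (R : realType) (G : sgraph) (a : R) :
  eigenvalue (adjacency R G) a ->
  exists (y : G -> R) (u : G), subeigen a y u.
Proof.
case/eigenvalueP => v vA v_neq0.
pose y x := `|v 0 (enum_rank x)|.
have [i0 vi0] : exists i, v 0 i != 0.
  apply/existsP; apply: contra_neqT v_neq0 => /existsPn v0.
  by apply/rowP => i; rewrite mxE; apply/eqP; rewrite -[_ == _]negbK.
pose u := [arg max_(x > enum_val i0 | true) y x]%O.
have y_le x : y x <= y u.
  by rewrite /u; case: arg_maxP => // z _ /(_ x); exact.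
have yu_gt0 : 0 < y u.
  by apply: lt_le_trans (y_le (enum_val i0)); rewrite /y enum_valK normr_gt0.
have sub x : a * y x <= \sum_z (adj x z)%:R * y z.
  (* Since [a] may be negative, only [a |v x| <= |a v x|] is available before the triangle
     inequality. *)
  apply: (@le_trans _ _ `|a * v 0 (enum_rank x)|).
    by rewrite normrM; apply: ler_wpM2r; rewrite ?normr_ge0 ?ler_norm.
  have -> : a * v 0 (enum_rank x) = (v *m adjacency R G) 0 (enum_rank x).
    by rewrite vA mxE.
  rewrite adjacency_mulE; apply: le_trans (ler_norm_sum _ _ _) _.
  by apply: ler_sum => z _; rewrite normrM normr_nat.
exists (fun x => y x / y u), u; split=> [x||x].
- by rewrite ler_pdivrMr // mul1r y_le andbT divr_ge0 ?normr_ge0.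
- by rewrite divff // gt_eqF.
- under eq_bigr do rewrite mulrA.
  by rewrite -mulr_suml mulrA; apply: ler_wpM2r; rewrite // invr_ge0 ltW.
Qed.

(** * Edge counts and isomorphisms *)

Lemma sum_adj_edges (G : sgraph) :
  (\sum_(x : G) \sum_z adj x z = 2 * #|edges G|)%N.
Proof.
rewrite pair_big /=.
rewrite (eq_bigr (fun p : G * G => if adj p.1 p.2 then 1 else 0)%N); last first.
  by move=> p _; case: (adj _ _).
rewrite -big_mkcond /=.
(* Ordered adjacent pairs are grouped by the edge they span; the fibre of [{a, b}] consists of
   [(a, b)] and [(b, a)], which differ by irreflexivity. *)
rewrite (partition_big (fun p : G * G => [set p.1; p.2]%SET) (mem (edges G))) /=.
  rewrite mulnC -sum_nat_const; apply: eq_bigr => E.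
  rewrite inE => /existsP[a /existsP[b /andP[ab /eqP->]]].
  rewrite sum1_card.
  have neq_ab : a != b by apply: contraTneq ab => ->; rewrite adj_irr.
  rewrite (@eq_card _ _ (mem [set (a, b); (b, a)]%SET)).
    by rewrite cards2 xpair_eqE (negPf neq_ab).
  move=> [x z]; rewrite !inE !xpair_eqE unfold_in /=.
  apply/andP/orP => [[xz /eqP/setP E2]|].
    have xab := E2 x; have zab := E2 z; rewrite !inE !eqxx ?orbT in xab zab.
    have: x != z by apply: contraTneq xz => ->; rewrite adj_irr.
    by case/esym/orP: xab => /eqP->; case/esym/orP: zab => /eqP->;
      rewrite !eqxx; [|left|right|].
  case=> /andP[/eqP-> /eqP->]; rewrite ?eqxx //; split=> //.
    by rewrite adj_sym.
  by rewrite finset.setUC.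
move=> [x z] /= xz; rewrite inE; apply/existsP; exists x; apply/existsP.
by exists z; rewrite xz eqxx.
Qed.

Lemma isomorphic_inv (G H : sgraph) (g : H -> G) :
  bijective g -> (forall i j, adj (g i) (g j) = adj i j) -> isomorphic G H.
Proof.
move=> [f gK fK] adjg; exists f => [|x z]; first by exists g.
by rewrite -adjg !fK.
Qed.

Lemma isomorphic_Kbip (G : sgraph) (X : {set G}) :
  (forall x z, adj x z = (x \in X) (+) (z \in X)) ->
  isomorphic G (Kbip #|X| #|finset.setC X|).
Proof.
move=> adjX.
pose g (i : Kbip #|X| #|finset.setC X|) : G :=
  match i with inl i => enum_val i | inr j => enum_val j end.
have gX i : (g i \in X) = (if i is inl _ then true else false).
  by case: i => i /=; have := enum_valP i; rewrite ?inE // => /negPf.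
apply: (@isomorphic_inv _ _ g) => [|i j]; last by rewrite adjX !gX; case: i; case: j.
apply: inj_card_bij => [i j gij|].
  have : (g i \in X) = (g j \in X) by rewrite gij.
  by rewrite !gX; case: i j gij => i [] j //= /enum_val_inj->.
by rewrite card_sum !card_ord cardsC.
Qed.

(** * Graphs without [K_{2,r+1}] *)

Lemma codegree_le (R : realFieldType) (G : sgraph) (r : nat) (x z : G) :
  ~ contains G (Kbip 2 r.+1) -> x != z ->
  \sum_w (adj x w)%:R * (adj w z)%:R <= r%:R :> R.
Proof.
move=> G_free neq_xz.
pose N := [set w | adj x w && adj w z]%SET.
have -> : \sum_w (adj x w)%:R * (adj w z)%:R = #|N|%:R :> R.
  rewrite -sum1_card natr_sum [RHS]big_mkcond /=; apply: eq_bigr => w _.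
  by rewrite inE -natrM mulnb; case: (_ && _).
(* Otherwise [x] and [z] form the side of size 2, and [r + 1] of their common neighbours form the
   other side. *)
rewrite ler_nat leqNgt; apply/negP => ltrN; apply: G_free.
pose f (i : Kbip 2 r.+1) : G := match i with
  | inl i => if i == ord0 then x else z
  | inr j => enum_val (widen_ord ltrN j) end.
have fN j : (adj x (f (inr j))) && (adj (f (inr j)) z).
  by have := enum_valP (widen_ord ltrN j); rewrite inE.
have adjf i j : adj (f (inl i)) (f (inr j)).
  by have /andP[xf fz] := fN j; rewrite /f; case: ifP => _; rewrite // adj_sym.
exists f => [[i|i] [j|j]|[i|i] [j|j]] //=.
- move=> fij; congr inl; apply/val_inj; move: fij.
  case: i j => [[|[|[]]] //= ?] [[|[|[]]] //= ?] // /eqP.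
    by rewrite (negPf neq_xz).
  by rewrite eq_sym (negPf neq_xz).
- by move=> fij; have := adjf i j; rewrite /f fij adj_irr.
- by move=> fij; have := adjf j i; rewrite /f fij adj_irr.
- by move/enum_val_inj/(congr1 val) => /= ij; congr inr; apply/val_inj.
- by move=> _; exact: adjf.
- by move=> _; rewrite adj_sym; exact: adjf.
Qed.

Lemma sum_degree (R : realFieldType) (G : sgraph) :
  \sum_(x : G) \sum_z (adj x z)%:R = 2 * #|edges G|%:R :> R.
Proof.
rewrite -natrM -sum_adj_edges natr_sum; apply: eq_bigr => x _.
by rewrite natr_sum.
Qed.

(** The inequality is used twice, at [x] and at its neighbours; the inner sum is the entry of the
    squared adjacency matrix, counting walks of length two. *)
Lemma subeigen_walk2 (R : realFieldType) (G : sgraph) (a : R) (y : G -> R)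
    (u x : G) :
  0 <= a -> subeigen a y u ->
  a ^+ 2 * y x <= \sum_z (\sum_w (adj x w)%:R * (adj w z)%:R) * y z.
Proof.
move=> a_ge0 [_ _ sub]; rewrite expr2 -mulrA.
apply: le_trans (ler_wpM2l a_ge0 (sub x)) _; rewrite mulr_sumr.
under [leRHS]eq_bigr do rewrite mulr_suml.
rewrite exchange_big /=; apply: ler_sum => w _.
rewrite mulrCA.
under eq_bigr do rewrite -mulrA.
by rewrite -mulr_sumr; apply: ler_wpM2l.
Qed.

Lemma sum_adj_sym (R : realFieldType) (G : sgraph) (u : G) :
  \sum_(x | x != u) (adj x u)%:R = \sum_x (adj u x)%:R :> R.
Proof.
rewrite [RHS](bigD1 u) //= adj_irr add0r.
by apply: eq_bigr => x _; rewrite adj_sym.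
Qed.

Lemma sum_degreeD1 (R : realFieldType) (G : sgraph) (u : G) :
  \sum_(x : G) \sum_z (adj x z)%:R =
  2 * \sum_z (adj u z)%:R
  + \sum_(x | x != u) \sum_(z | z != u) (adj x z)%:R :> R.
Proof.
rewrite (bigD1 u) //= mulr_natl mulr2n -addrA; congr (_ + _).
rewrite -sum_adj_sym -big_split /=; apply: eq_bigr => x _.
by rewrite [LHS](bigD1 u).
Qed.

(** The double sum meets each edge from [x] to a vertex other than [u] twice, in row [x] and in
    column [x]; the possible edge [x u] accounts for the constant 2. *)
Lemma degree_off_vertex (R : realFieldType) (G : sgraph) (u x : G) :
  x != u ->
  2 * \sum_z (adj x z)%:R <=
  2 + \sum_(x | x != u) \sum_(z | z != u) (adj x z)%:R :> R.
Proof.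
move=> neq_xu; rewrite (bigD1 u) //= mulrDr; apply: lerD.
  by case: (adj _ _); rewrite ?mulr1 ?mulr0.
rewrite [leRHS](bigD1 x) //= mulr_natl mulr2n lerD2l.
rewrite (bigD1 x) //= adj_irr add0r.
rewrite [leRHS](eq_bigl (fun z => (z != u) && (z != x))) //.
apply: ler_sum => z _; rewrite (bigD1 x) //= adj_sym lerDl.
by apply: sumr_ge0.
Qed.

Lemma K2_free_subeigen (R : realFieldType) (G : sgraph) (r : nat) (a : R)
    (y : G -> R) (u : G) :
  (2 <= r)%N -> (16 * r ^ 2 <= #|edges G|)%N -> ~ contains G (Kbip 2 r.+1) ->
  subeigen a y u -> 0 <= a -> #|edges G|%:R <= a ^+ 2 ->
  a ^+ 2 <= #|edges G|%:R /\
  forall x z, x != u -> z != u -> ~~ adj x z.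
Proof.
move=> r_ge2 m_ge G_free ysub a_ge0 le_ma.
have [y01 yu sub] := ysub.
have y_ge0 x : 0 <= y x by case/andP: (y01 x).
have e_ge0 (x z : G) : 0 <= (adj x z)%:R :> R by rewrite ler0n.
(* Defining [M] requires a vertex other than [u]; if there is none, [u] has no neighbour and
   [a = 0]. *)
have [z1 z1u|all_u] := pickP (fun z => z != u); last first.
  have triv z : z = u by apply/eqP; rewrite -[_ == _]negbK all_u.
  split=> [|x z]; last by rewrite (triv x) eqxx.
  suff -> : a = 0 by rewrite expr2 mul0r.
  apply/eqP; rewrite eq_le a_ge0 andbT; have := sub u; rewrite yu mulr1.
  by rewrite big1 // => z _; rewrite (triv z) adj_irr mul0r.
pose z0 := [arg max_(x > z1 | x != u) y x]%O.
have [z0u y_max] : z0 != u /\ forall z, z != u -> y z <= y z0.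
  by rewrite /z0; case: arg_maxP.
set mm := _%:R in le_ma *.
set M := y z0 in y_max.
have [M_ge0 M_le1] : 0 <= M /\ M <= 1 by apply/andP/y01.
set D : R := \sum_z (adj u z)%:R.
(* [F] counts every edge off [u] twice, so [m = D + F / 2]. *)
set F : R := \sum_(x | x != u) \sum_(z | z != u) (adj x z)%:R.
have F_ge0 : 0 <= F by apply: sumr_ge0 => x _; apply: sumr_ge0.
have mE : 2 * mm = 2 * D + F by rewrite -sum_degree (sum_degreeD1 _ u).
set S := \sum_(z | z != u) y z.
have walk_le (x : G) :
    \sum_z (adj x z)%:R * y z <=
    (adj x u)%:R + \sum_(z | z != u) (adj x z)%:R * M.
  rewrite (bigD1 u) //= yu mulr1 lerD2l.
  by apply: ler_sum => z zu; apply: ler_wpM2l => //; exact: y_max.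
(* The inequality is summed over all [x != u], with every entry off [u] bounded by [M]. *)
have aS_le : a * S <= D + F * M.
  rewrite mulr_sumr /D -sum_adj_sym mulr_suml -big_split /=.
  apply: ler_sum => x xu; apply: le_trans (sub x) _.
  by rewrite mulr_suml; exact: walk_le.
have a2_le : a ^+ 2 <= D + F * M.
  have := ler_wpM2l a_ge0 (sub u); rewrite yu mulr1 -expr2 => /le_trans; apply.
  rewrite mulr_sumr (bigD1 u) //= adj_irr mul0r mulr0 add0r.
  rewrite /D -sum_adj_sym mulr_suml -big_split /=.
  apply: ler_sum => x xu; rewrite mulrCA.
  have := ler_wpM2l (e_ge0 u x) (sub x) => /le_trans; apply.
  have := ler_wpM2l (e_ge0 u x) (walk_le x) => /le_trans; apply.
  rewrite mulr_suml adj_sym; case: (adj x u); rewrite ?mul1r // mul0r add0r.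
  by apply: sumr_ge0 => z _; rewrite mulr_ge0.
pose rr : R := r%:R.
have codeg_le (x z : G) : x != z ->
    \sum_w (adj x w)%:R * (adj w z)%:R <= rr by exact: codegree_le.
have rr_ge2 : 2 <= rr by rewrite ler_nat.
have mm_ge : 16 * rr ^+ 2 <= mm by rewrite -natrX -natrM ler_nat.
have a_ge : 4 * rr <= a.
  rewrite -(@ler_pXn2r _ 2) ?nnegrE //; last lra.
  by rewrite exprMn; apply: le_trans le_ma; lra.
have a2_leS : a ^+ 2 <= D + rr * S.
  have := subeigen_walk2 u a_ge0 ysub; rewrite yu mulr1 => /le_trans; apply.
  rewrite (bigD1 u) //= yu mulr1; apply: lerD.
    by apply: ler_sum => w _; rewrite adj_sym -natrM mulnb andbb.
  rewrite mulr_sumr; apply: ler_sum => z zu; apply: ler_wpM2r => //.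
  by apply: codeg_le; rewrite // eq_sym.
have degz0 := degree_off_vertex R z0u; rewrite -/F in degz0.
(* Walks of length two from [z0] are split by their end: at most [r] end at [u],
   [deg z0 <= 1 + F / 2] return to [z0], and at most [r] reach any other vertex. *)
have a2M_le : a ^+ 2 * M <= (1 + F / 2) * M + rr + rr * (S - M).
  have := subeigen_walk2 z0 a_ge0 ysub => /le_trans; apply.
  rewrite (bigD1 u) //= yu mulr1 [X in _ + X <= _](bigD1 z0) //= -/M.
  rewrite [S](bigD1 z0) //= -/M.
  rewrite [M + _]addrC addrK.
  rewrite [X in _ <= X + _]addrC -[leRHS]addrA; apply: lerD.
    exact: codeg_le.
  apply: lerD.
    apply: ler_wpM2r => //.
    apply: (@le_trans _ _ (\sum_z (adj z0 z)%:R)); last lra.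
    by apply: ler_sum => w _; rewrite adj_sym -natrM mulnb andbb.
  rewrite mulr_sumr; apply: ler_sum => z /andP[_ zz0].
  by apply: ler_wpM2r => //; apply: codeg_le; rewrite // eq_sym.
have S_ge0 : 0 <= S by exact: sumr_ge0.
have rS_le : 4 * (rr * S) <= D + F * M.
  by apply: le_trans aS_le; rewrite mulrA ler_wpM2r.
have FM_le : F * M <= F by rewrite ler_piMr.
(* Combine [D + F / 2 = m <= a^2 <= D + r S] with [4 r S <= D + F]. *)
have leFD : F <= D by lra.
have M_lt : M < 2^-1.
  rewrite ltNge; apply/negP => M_ge.
  have : (D - 1 + rr - F / 4) * M <= rr + D / 4.
    have := ler_wpM2r M_ge0 le_ma; have -> : mm = D + F / 2 by lra.
    lra.
  (* From [m = D + F / 2 <= 3 D / 2] and [m >= 16 r^2 >= 32 r] comes [D >= 20 r], whereas [M >= 1/2]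
     forces [D <= 4 r + 4]. *)
  have : rr * 2 <= rr ^+ 2 by rewrite expr2 ler_wpM2l //; lra.
  move=> rr2 ineq.
  have D_ge : 20 * rr <= D by lra.
  have : (3 * D / 4 + rr - 1) * 2^-1 <= (D - 1 + rr - F / 4) * M.
    by apply: ler_pM => //; lra.
  lra.
(* Here [D + F / 2 = m <= a^2 <= D + F M] yields [F (1/2 - M) <= 0]. *)
have F0 : F = 0.
  apply/eqP; rewrite eq_le F_ge0 andbT -(@pmulr_lle0 _ (2^-1 - M)) ?subr_gt0 //.
  by rewrite mulrBr; lra.
split=> [|x z xu zu]; first by move: a2_le mE; rewrite F0; lra.
have sum_ge0 x' : 0 <= \sum_(z | z != u) (adj x' z)%:R :> R.
  by apply: sumr_ge0.
have Fx : \sum_(z | z != u) (adj x z)%:R = 0 :> R.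
  by apply: (psumr_eq0P _ F0).
by have /eqP := psumr_eq0P (fun _ _ => e_ge0 _ _) Fx zu; rewrite pnatr_eq0 eqb0.
Qed.

(** * Graphs without [C_3^+] and [C_4^+] *)

Lemma contains_Cplus3 (G : sgraph) (u w x1 x2 : G) :
  adj u w -> adj u x1 -> adj w x1 -> adj u x2 -> adj w x2 -> x1 != x2 ->
  contains G (Cplus 3).
Proof.
move=> uw ux1 wx1 ux2 wx2 neq_x; pose s := [:: x2; u; w; x1].
(* [None] reads the head [x2] of [s], and the cycle vertices 0, 1, 2 read [u], [w], [x1]; the glued
   edge [{0, 1}] becomes [u w]. *)
pose f (i : Cplus 3) := nth u s (if i is Some j then j.+1 else 0%N).
have neq (a b : G) : adj a b -> (a == b = false) * (b == a = false).
  by move=> ab; split; apply/eqP => E; rewrite E adj_irr in ab.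
have s_uniq : uniq s.
  by rewrite /= !inE !(neq _ _ uw) !(neq _ _ ux1) !(neq _ _ wx1)
    !(neq _ _ ux2) !(neq _ _ wx2) eq_sym (negPf neq_x).
exists f => [i j /eqP|].
  rewrite nth_uniq //; try by [case: (i) => [[]|] | case: (j) => [[]|]].
  by case: i j => [i|] [j|] //= /eqP[/val_inj->].
by move=> [[[|[|[|i]]] //= ?]|] [[[|[|[|j]]] //= ?]|] //=; rewrite /f //= adj_sym.
Qed.

(** The 4-cycle is [u w z w'], and the triangle [u w x] is glued along its edge [u w]. *)
Lemma contains_Cplus4 (G : sgraph) (u w x z w' : G) :
  adj u w -> adj u x -> adj w x -> adj w z -> adj z w' -> adj u w' ->
  z != u -> z != x -> w' != w -> w' != x -> contains G (Cplus 4).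
Proof.
move=> uw ux wx wz zw' uw' neq_zu neq_zx neq_w'w neq_w'x.
pose s := [:: x; u; w; z; w'].
pose f (i : Cplus 4) := nth u s (if i is Some j then j.+1 else 0%N).
have neq (a b : G) : adj a b -> (a == b = false) * (b == a = false).
  by move=> ab; split; apply/eqP => E; rewrite E adj_irr in ab.
have s_uniq : uniq s.
  rewrite /= !inE !(neq _ _ uw) !(neq _ _ ux) !(neq _ _ wx) !(neq _ _ wz).
  rewrite !(neq _ _ zw') !(neq _ _ uw') [u == z]eq_sym [x == z]eq_sym.
  rewrite [x == w']eq_sym [w == w']eq_sym (negPf neq_zu) (negPf neq_zx).
  by rewrite (negPf neq_w'w) (negPf neq_w'x).
exists f => [i j /eqP|].
  rewrite nth_uniq //; try by [case: (i) => [[]|] | case: (j) => [[]|]].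
  by case: i j => [i|] [j|] //= /eqP[/val_inj->].
by move=> [[[|[|[|[|i]]]] //= ?]|] [[[|[|[|[|j]]]] //= ?]|] //=;
  rewrite /f //= adj_sym.
Qed.

Lemma sum_uniq_indicator (R : realFieldType) (T : finType) (P Q : pred T) :
  (forall x z, P x -> Q x -> P z -> Q z -> x = z) ->
  \sum_(x | P x) (Q x)%:R = [exists x, P x && Q x]%:R :> R.
Proof.
move=> PQ_uniq; case: existsP => [[x0 /andP[Px0 Qx0]]|PQ0]; last first.
  rewrite big1 // => x Px; case: (boolP (Q x)) => // Qx.
  by case: PQ0; exists x; rewrite Px.
rewrite (bigD1 x0) //= Qx0 big1 ?addr0 // => x /andP[Px neq_x].
by case: (boolP (Q x)) => // Qx; rewrite (PQ_uniq x x0) ?eqxx in neq_x.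
Qed.

Lemma sum_neighborhood (R : realFieldType) (G : sgraph) (u : G) (f : G -> R) :
  \sum_z f z = f u + \sum_(z | adj u z) f z
               + \sum_(z | (z != u) && ~~ adj u z) f z.
Proof.
rewrite (bigD1 u) //= (bigID (adj u)) /= addrA; congr (_ + _ + _).
apply: eq_bigl => z; case: eqVneq => // ->; by rewrite adj_irr.
Qed.

Definition in_triangle (G : sgraph) (u w : G) := [exists x, adj u x && adj x w].

(** Two neighbours of [w] inside [N(u)] would give two triangles on the edge [u w]. So [N(u)]
    induces a matching, and [in_triangle u] marks its matched vertices. *)
Lemma Cplus3_free_codegree (R : realFieldType) (G : sgraph) (u w : G) :
  ~ contains G (Cplus 3) -> adj u w ->
  \sum_(x | adj u x) (adj x w)%:R = (in_triangle u w)%:R :> R.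
Proof.
move=> C3_free uw; apply: sum_uniq_indicator => x1 x2 ux1 x1w ux2 x2w.
apply: contra_notP C3_free => /eqP.
by apply: contains_Cplus3 uw ux1 _ ux2 _; rewrite adj_sym.
Qed.

(** Let [x] be the third vertex of the triangle. A second neighbour [w' = x] would give two
    triangles on [w x]; any other would close the 4-cycle [u w z w'], with the triangle [u w x] on
    its edge [u w]. *)
Lemma triangle_outside_neighbor (G : sgraph) (u w w' z : G) :
  ~ contains G (Cplus 3) -> ~ contains G (Cplus 4) ->
  z != u -> ~~ adj u z -> adj u w -> in_triangle u w -> adj w z ->
  adj u w' -> adj w' z -> w' = w.
Proof.
move=> C3_free C4_free zu uz uw /existsP[x /andP[ux xw]] wz uw' w'z.
apply/eqP/negPn/negP => neq_w.
have [eq_w'x|neq_w'x] := eqVneq w' x.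
  apply: C3_free; rewrite eq_w'x in w'z.
  apply: (contains_Cplus3 (u := w) (w := x) (x1 := u) (x2 := z)) => //;
    rewrite 1?adj_sym // eq_sym //.
apply: C4_free; apply: (contains_Cplus4 uw ux _ wz _ uw' zu _ neq_w neq_w'x).
- by rewrite adj_sym.
- by rewrite adj_sym.
- by apply: contraNneq uz => ->.
Qed.

Lemma sum_degree_neighbors (R : realFieldType) (G : sgraph) (u : G) :
  ~ contains G (Cplus 3) ->
  \sum_(w | adj u w) \sum_z (adj w z)%:R =
  \sum_(w | adj u w) 1 + \sum_(w | adj u w) (in_triangle u w)%:R
  + \sum_(z | (z != u) && ~~ adj u z) \sum_(w | adj u w) (adj w z)%:R :> R.
Proof.
move=> C3_free; rewrite [X in _ + X]exchange_big /= -!big_split /=.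
apply: eq_bigr => w uw.
rewrite (sum_neighborhood u) adj_sym uw -Cplus3_free_codegree //.
by congr (_ + _ + _); apply: eq_bigr => x _; rewrite adj_sym.
Qed.

(** The degree sum is split over [u], [N(u)] and the outside; edges at [u] and edges from [N(u)] to
    the outside are met from both parts, hence the factors 2. *)
Lemma edges_neighborhood (R : realFieldType) (G : sgraph) (u : G) :
  ~ contains G (Cplus 3) ->
  2 * #|edges G|%:R =
  2 * (\sum_(w | adj u w) 1) + \sum_(w | adj u w) (in_triangle u w)%:R
  + 2 * (\sum_(z | (z != u) && ~~ adj u z) \sum_(w | adj u w) (adj w z)%:R)
  + \sum_(z | (z != u) && ~~ adj u z)
      \sum_(x | (x != u) && ~~ adj u x) (adj z x)%:R :> R.
Proof.
move=> C3_free.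
rewrite -sum_degree (sum_neighborhood u) sum_degree_neighbors //.
have -> : \sum_z (adj u z)%:R = \sum_(w | adj u w) 1 :> R.
  by rewrite [RHS]big_mkcond; apply: eq_bigr => w _; case: (adj u w).
have -> : \sum_(z | (z != u) && ~~ adj u z) \sum_x (adj z x)%:R =
    \sum_(z | (z != u) && ~~ adj u z) \sum_(w | adj u w) (adj w z)%:R
    + \sum_(z | (z != u) && ~~ adj u z)
      \sum_(x | (x != u) && ~~ adj u x) (adj z x)%:R :> R.
  rewrite -big_split /=; apply: eq_bigr => z /andP[zu uz].
  rewrite (sum_neighborhood u) adj_sym (negPf uz) add0r; congr (_ + _).
  by apply: eq_bigr => w _; rewrite adj_sym.
ring.
Qed.

Lemma house_free_subeigen (R : realFieldType) (G : sgraph) (a : R)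
    (y : G -> R) (u : G) :
  no_isolated G -> ~ contains G (Cplus 3) -> ~ contains G (Cplus 4) ->
  subeigen a y u -> 3 <= a -> #|edges G|%:R <= a ^+ 2 ->
  [/\ a ^+ 2 <= #|edges G|%:R,
      forall z, z != u -> ~~ adj u z -> y z = 1,
      forall z x, z != u -> ~~ adj u z -> x != u -> ~~ adj u x -> ~~ adj z x,
      forall z w, z != u -> ~~ adj u z -> adj u w -> adj w z ->
        ~~ in_triangle u w
    & (forall w, adj u w -> ~~ in_triangle u w) \/ a = 3].
Proof.
move=> G_noiso C3_free C4_free [y01 yu sub] a_ge3 le_ma.
have a_ge0 : 0 <= a by lra.
have y_ge0 x : 0 <= y x by case/andP: (y01 x).
have y_le1 x : y x <= 1 by case/andP: (y01 x).
have e_ge0 (x z : G) : 0 <= (adj x z)%:R :> R by rewrite ler0n.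
pose A z := adj u z; pose B z := (z != u) && ~~ adj u z.
pose t w : R := (in_triangle u w)%:R.
pose c z : R := \sum_(w | A w) (adj w z)%:R.
pose c' z : R := \sum_(w | A w) t w * (adj w z)%:R.
pose d z : R := \sum_(x | B x) (adj z x)%:R.
have cA w : A w -> c w = t w by exact: Cplus3_free_codegree.
have walk x : a * y x <= (adj x u)%:R + \sum_(w | A w) (adj x w)%:R * y w
    + \sum_(z | B z) (adj x z)%:R * y z.
  by apply: le_trans (sub x) _; rewrite (sum_neighborhood u) yu mulr1.
have walkA w : A w -> a * y w <= 1 + \sum_(x | A x) (adj w x)%:R * y x
    + \sum_(z | B z) (adj w z)%:R * y z.
  by move=> uw; have := walk w; rewrite adj_sym -/(A w) uw.
set D : R := \sum_(w | A w) 1.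
set Y := \sum_(w | A w) t w * y w.
set T := \sum_(w | A w) t w.
set CY := \sum_(z | B z) c z * y z.
set C'Y := \sum_(z | B z) c' z * y z.
set C := \sum_(z | B z) c z.
set E := \sum_(z | B z) d z.
have mE : 2 * #|edges G|%:R = 2 * D + T + 2 * C + E.
  exact: edges_neighborhood.
set mm := _%:R in le_ma mE *.
have t_ge0 w : 0 <= t w by rewrite ler0n.
have Y_ge0 : 0 <= Y by apply: sumr_ge0 => w _; rewrite mulr_ge0.
(* The inequality is applied at [u], then at its neighbours; as these induce a matching, walks
   staying among them contribute exactly [Y]. *)
have a2_le : a ^+ 2 <= D + Y + CY.
  have ay : a <= \sum_(w | A w) y w.
    have := walk u; rewrite yu mulr1 adj_irr add0r => /le_trans; apply.
    rewrite [X in _ + X]big1 ?addr0 => [|z /andP[_ /negPf->]]; last by rewrite mul0r.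
    by apply: ler_sum => w; rewrite /A => ->; rewrite mul1r.
  apply: le_trans (ler_wpM2l a_ge0 ay) _; rewrite mulr_sumr.
  apply: le_trans (ler_sum _ walkA) _; rewrite !big_split /=.
  rewrite lerD ?lerD //.
    rewrite exchange_big /=; apply: ler_sum => x ux.
    by rewrite -mulr_suml -cA.
  rewrite exchange_big /=; apply: ler_sum => z _.
  by rewrite -mulr_suml.
(* The inequality is summed over the matched neighbours; walks inside [N(u)] contribute at most [Y],
   which is absorbed on the left. *)
have Y_le : (a - 1) * Y <= T + C'Y.
  suff : a * Y <= T + Y + C'Y by lra.
  rewrite mulr_sumr; apply: (@le_trans _ _ (\sum_(w | A w) (t w
    + \sum_(x | A x) (adj w x)%:R * y x
    + \sum_(z | B z) t w * (adj w z)%:R * y z))).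
    apply: ler_sum => w uw; rewrite mulrCA.
    apply: le_trans (ler_wpM2l (t_ge0 w) (walkA w uw)) _.
    rewrite !mulrDr mulr1 lerD ?lerD //.
      by apply: ler_piMl; [apply: sumr_ge0 => x _; exact: mulr_ge0
        | rewrite lern1 leq_b1].
    by rewrite mulr_sumr; apply: ler_sum => z _; rewrite mulrA.
  rewrite !big_split /= lerD ?lerD //.
    rewrite exchange_big /=; apply: ler_sum => x ux.
    by rewrite -mulr_suml -cA.
  rewrite exchange_big /=; apply: ler_sum => z _.
  by rewrite -mulr_suml.
(* Twice the contribution of the outside vertex [z] to the deficit; when
   [c' z = 1], also [c z = 1] and [3 y z <= 1 + d z], whence [g z >= 1]. *)
pose g z := 2 * (c z * (1 - y z)) - c' z * y z + d z.
have gE : \sum_(z | B z) g z = 2 * C - 2 * CY - C'Y + E.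
  rewrite !mulr_sumr -!sumrB -big_split /=; apply: eq_bigr => z _.
  by rewrite /g; ring.
have Y_le2 : 2 * Y <= (a - 1) * Y by apply: ler_wpM2r => //; lra.
(* Comparing [2 m <= 2 a^2 <= 2 D + 2 Y + 2 CY] with [mE] leaves [T + 2 C + E <= 2 Y + 2 CY], and
   [2 Y <= T + C'Y]. *)
have g_sum_le0 : \sum_(z | B z) g z <= 0 by lra.
have c_ge0 z : 0 <= c z by apply: sumr_ge0.
have d_ge0 z : 0 <= d z by apply: sumr_ge0.
have linked z : B z -> [exists w, [&& A w, in_triangle u w & adj w z]] ->
    1 <= g z.
  move=> Bz /existsP[w /and3P[uw tw wz]]; have [zu uz] := andP Bz.
  have w_uniq w' : A w' -> adj w' z -> w' = w.
    by move=> uw' w'z; apply: triangle_outside_neighbor tw wz uw' w'z.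
  have cz : c z = 1.
    rewrite /c (bigD1 w) //= wz big1 ?addr0 // => w' /andP[uw' neq_w].
    by case: (boolP (adj w' z)) => // /w_uniq E'; rewrite E' ?eqxx in neq_w.
  have c'z : c' z = 1.
    rewrite /c' (bigD1 w) //= wz /t tw mul1r big1 ?addr0 // => w' /andP[uw' neq_w].
    case: (boolP (adj w' z)); rewrite ?mulr0 // => /w_uniq E'.
    by rewrite E' ?eqxx in neq_w.
  have : 3 * y z <= 1 + d z.
    apply: le_trans (ler_wpM2r (y_ge0 z) a_ge3) _; apply: le_trans (walk z) _.
    rewrite adj_sym (negPf uz) add0r -[X in X + d z]cz.
    apply: lerD; apply: ler_sum => x _.
      by rewrite adj_sym ler_piMr.
    by rewrite ler_piMr.
  by rewrite /g cz c'z; lra.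
have unlinked z : B z -> ~~ [exists w, [&& A w, in_triangle u w & adj w z]] ->
    c' z = 0.
  move=> Bz /existsPn tz; apply: big1 => w uw.
  rewrite -natrM mulnb; have := tz w; rewrite uw /=.
  by move/negPf->.
have g_ge0 z : B z -> 0 <= g z.
  move=> Bz; have [/(linked z Bz)|/(unlinked z Bz) c'0] :=
    boolP [exists w, [&& A w, in_triangle u w & adj w z]].
    by apply: le_trans.
  rewrite /g c'0 mul0r subr0 addr_ge0 // mulr_ge0 // mulr_ge0 // subr_ge0.
  exact: y_le1.
have gsum0 : \sum_(z | B z) g z = 0.
  by apply/eqP; rewrite eq_le g_sum_le0 sumr_ge0.
have g0 z : B z -> g z = 0 by exact: psumr_eq0P.
have Bunlinked z : B z -> ~~ [exists w, [&& A w, in_triangle u w & adj w z]].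
  by move=> Bz; apply/negP => /(linked z Bz); rewrite g0 // ler10.
have Bcd z : B z -> c z * (1 - y z) = 0 /\ d z = 0.
  move=> Bz; have := g0 z Bz; rewrite /g (unlinked z Bz (Bunlinked z Bz)).
  have : 0 <= c z * (1 - y z) by rewrite mulr_ge0 // subr_ge0.
  by have := d_ge0 z; split; lra.
have Bindep z x : B z -> B x -> ~~ adj z x.
  move=> /Bcd[_ dz] Bx; have /eqP := psumr_eq0P (fun _ _ => e_ge0 _ _) dz Bx.
  by rewrite pnatr_eq0 eqb0.
split.
- by lra.
- move=> z zu uz; have Bz : B z by rewrite /B zu.
  have [x zx] := G_noiso z.
  (* The outside is independent, so the neighbour of [z] lies in [N(u)]; hence [c z > 0], and
     [c z * (1 - y z) = 0] gives [y z = 1]. *)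
  have ux : A x.
    have : ~~ B x by apply: contraL zx; exact: Bindep.
    rewrite negb_and !negbK => /orP[/eqP xu|//].
    by rewrite xu adj_sym (negPf uz) in zx.
  have : 0 < c z.
    by rewrite /c (bigD1 x) //= adj_sym zx ltr_pwDl // sumr_ge0.
  move=> /lt0r_neq0 c_neq0; have [/eqP] := Bcd z Bz.
  by rewrite mulf_eq0 (negPf c_neq0) subr_eq0 => /eqP.
- by move=> z x zu uz xu ux; apply: Bindep; apply/andP.
- move=> z w zu uz uw wz.
  have /existsPn/(_ w) := Bunlinked z (introT andP (conj zu uz)).
  by rewrite /A uw wz andbT.
have [->|neq_a3] := eqVneq a 3; [by right | left].
have a_gt3 : 0 < a - 3 by rewrite subr_gt0 lt_neqAle eq_sym neq_a3.
(* As the sum of [g] vanishes, [(a - 1) Y <= T + C'Y <= 2 Y]; for [a > 3] this makes [Y] vanish, and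
   then [T]. *)
have Y_le0 : Y <= 0.
  rewrite -(pmulr_rle0 _ a_gt3); lra.
have C'Y_ge0 : 0 <= C'Y.
  apply: sumr_ge0 => z _; rewrite mulr_ge0 // sumr_ge0 // => w _.
  exact: mulr_ge0.
have T0 : T = 0.
  by apply/eqP; rewrite eq_le sumr_ge0 // andbT; lra.
move=> w uw; have /eqP := psumr_eq0P (fun _ _ => t_ge0 _) T0 uw.
by rewrite pnatr_eq0 eqb0.
Qed.

(** * Structure of the extremal graphs in (ii) *)

Lemma matching_enum (T : finType) (e : rel T) (S : {set T}) :
  symmetric e -> irreflexive e ->
  (forall w x z, w \in S -> x \in S -> z \in S -> e w x -> e w z -> x = z) ->
  exists (s : seq T) (k : nat),
    [/\ uniq s, s =i S, (2 * k <= size s)%N,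
        forall x0 i j, (i < size s)%N -> (j < size s)%N ->
          e (nth x0 s i) (nth x0 s j)
            = [&& i != j, i./2 == j./2 & (i./2 < k)%N]
      & (\sum_(x <- s) \sum_(z <- s) e x z = 2 * k)%N].
Proof.
(* By induction on the size of [S], a matched pair is moved to the front, so partners occupy
   positions [2 l] and [2 l + 1] and unmatched elements come last. *)
move=> e_sym e_irr; have [n] := ubnP #|S|; elim: n S => // n IHn S leSn eS.
have [[w x] /= /and3P[wS xS ewx]|no_e] :=
  pickP [pred p : T * T | [&& p.1 \in S, p.2 \in S & e p.1 p.2]]; last first.
  have eS0 w x : w \in S -> x \in S -> e w x = false.
    by move=> wS xS; have := no_e (w, x); rewrite /= wS xS.
  exists (enum S), 0%N; split=> //.
  - exact: enum_uniq.
  - by move=> x; rewrite mem_enum.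
  - by move=> x0 i j si sj; rewrite eS0 ?andbF // -mem_enum mem_nth.
  - rewrite big1_seq // => x /andP[_]; rewrite mem_enum => xS.
    by rewrite big1_seq // => z /andP[_]; rewrite mem_enum => zS; rewrite eS0.
pose S' := (S :\ w :\ x)%SET.
have S'P z : (z \in S') = [&& z != x, z != w & z \in S] by rewrite !inE.
have neq_xw : x != w by apply: contraTneq ewx => ->; rewrite e_irr.
have ltS' : (#|S'| < n)%N.
  have := cardsD1 x (S :\ w)%SET; have := cardsD1 w S.
  by rewrite !inE neq_xw wS xS -/S'; lia.
have [|s [k [s_uniq sS' le_ks es sum_es]]] := IHn S' ltS'.
  move=> w1 x1 z1; rewrite !S'P => /and3P[_ _ ?] /and3P[_ _ ?] /and3P[_ _ ?].
  exact: eS.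
have ws z : z \in s -> e w z = false.
  rewrite sS' S'P => /and3P[neq_zx _ zS]; apply: contraNF neq_zx => ewz.
  by apply/eqP/esym; exact: eS wS xS zS ewx ewz.
have xs z : z \in s -> e x z = false.
  rewrite sS' S'P => /and3P[_ neq_zw zS]; apply: contraNF neq_zw => exz.
  by apply/eqP/esym/(eS x w z) => //; rewrite e_sym.
have sw z : z \in s -> e z w = false by rewrite e_sym; exact: ws.
have sx z : z \in s -> e z x = false by rewrite e_sym; exact: xs.
exists [:: w, x & s], k.+1; split.
- by rewrite /= inE !sS' !S'P !eqxx eq_sym (negPf neq_xw) andbF.
- move=> z; rewrite !inE sS' S'P.
  by case: eqVneq => [->|_]; rewrite ?wS //; case: eqVneq => [->|_].
- by rewrite /= mulnS; lia.
- move=> x0 [|[|i]] [|[|j]] si sj; rewrite /= ?e_irr ?ewx ?(e_sym x w) ?ewx //.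
  + by rewrite ws // mem_nth.
  + by rewrite xs // mem_nth.
  + by rewrite sw // mem_nth.
  + by rewrite sx // mem_nth.
  + by rewrite es // !eqSS ltnS.
- have big0 v : (forall z, z \in s -> e v z = false) ->
      (\sum_(z <- s) e v z = 0)%N.
    by move=> v0; rewrite big1_seq // => z /andP[_ /v0->].
  rewrite !big_cons !e_irr ewx (e_sym x w) ewx !big0 //.
  rewrite (eq_big_seq (fun z => \sum_(z' <- s) e z z')%N) ?sum_es => [|z zs].
    lia.
  by rewrite !big_cons sw // sx.
Qed.

(** Since [u] is adjacent to all, the other vertices induce a matching. Listing [u] before their
    enumeration shifts positions by one, which turns [i./2] into the [i.-1./2] of [Splus_adj]. *)
Lemma isomorphic_Splus (G : sgraph) (u : G) :
  ~ contains G (Cplus 3) -> (forall z, z != u -> adj u z) ->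
  exists k, [/\ (2 * k < #|G|)%N, isomorphic G (Splus #|G| k)
    & (\sum_(x | x != u) \sum_(z | z != u) adj x z = 2 * k)%N].
Proof.
move=> C3_free u_dom.
have matchU w x z : w \in [set~ u]%SET -> x \in [set~ u]%SET ->
    z \in [set~ u]%SET -> adj w x -> adj w z -> x = z.
  rewrite !inE => wu xu zu wx wz.
  apply: contra_notP C3_free => /eqP.
  by apply: contains_Cplus3 (u_dom w wu) (u_dom x xu) wx (u_dom z zu) wz.
have [s [k [s_uniq sU le_ks es sum_es]]] :=
  @matching_enum G (@adj G) [set~ u]%SET (@adj_sym G) (@adj_irr G) matchU.
have memU z : (z \in s) = (z != u) by rewrite sU !inE.
have us_uniq : uniq (u :: s) by rewrite /= memU eqxx.
have size_s : size (u :: s) = #|G|.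
  rewrite -(card_uniqP us_uniq); apply: eq_card => z.
  by rewrite !inE memU orbN.
exists k; split; first by rewrite -size_s ltnS.
  pose g (i : Splus #|G| k) : G := nth u (u :: s) i.
  apply: (@isomorphic_inv _ _ g) => [|i j].
    apply: inj_card_bij => [i j /eqP|]; last by rewrite card_ord.
    by rewrite nth_uniq ?size_s ?ltn_ord // => /eqP/val_inj.
  have lt_s (l : 'I_#|G|) : (l < (size s).+1)%N.
    by rewrite -[(size s).+1]/(size (u :: s)) size_s.
  rewrite /g /= /Splus_adj -val_eqE /=; move: (lt_s i) (lt_s j).
  case: (val i) => [|i']; case: (val j) => [|j'] /= lt_i lt_j.
  - by rewrite adj_irr.
  - by rewrite u_dom // -memU mem_nth.
  - by rewrite adj_sym u_dom // -memU mem_nth.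
  - by rewrite es // eqSS.
have sumE (f : G -> nat) : (\sum_(z | z != u) f z = \sum_(z <- s) f z)%N.
  rewrite big_uniq //=; apply: eq_bigl => z.
  by rewrite memU.
by rewrite sumE -sum_es; apply: eq_bigr => x _; rewrite sumE.
Qed.

Lemma house_free_extremal (R : realFieldType) (G : sgraph) (a : R)
    (y : G -> R) (u : G) :
  no_isolated G -> ~ contains G (Cplus 3) -> ~ contains G (Cplus 4) ->
  subeigen a y u -> 3 <= a -> #|edges G|%:R = a ^+ 2 ->
  complete_bipartite G \/ isomorphic G (Splus 7 3) \/
  isomorphic G (Splus 8 2) \/ isomorphic G (Splus 9 1).
Proof.
move=> G_noiso C3_free C4_free ysub a_ge3 mE.
have [|_ yB indepB triB triA] :=
  house_free_subeigen G_noiso C3_free C4_free ysub a_ge3.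
  by rewrite mE.
have [y01 yu sub] := ysub.
have a_ge0 : 0 <= a by lra.
pose A z := adj u z; pose B z := (z != u) && ~~ adj u z.
pose t w : R := (in_triangle u w)%:R.
pose deg (w : G) : R := \sum_z (adj w z)%:R.
have deg_gt0 w : 0 < deg w.
  have [x wx] := G_noiso w.
  by rewrite /deg (bigD1 x) //= wx ltr_pwDl // sumr_ge0.
set T := \sum_(w | A w) t w.
have t_ge0 w : 0 <= t w by rewrite ler0n.
have T_ge0 : 0 <= T by exact: sumr_ge0.
(* As the outside is independent, every edge meets [N(u)], and only the [T / 2] matching edges meet
   it twice. *)
have sum_deg : \sum_(w | A w) deg w = a ^+ 2 + T / 2.
  have := @edges_neighborhood R G u C3_free; rewrite mE.
  rewrite [X in _ + X]big1 => [|z /andP[zu uz]]; last first.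
    by rewrite big1 // => x /andP[xu ux]; rewrite (negPf (indepB _ _ _ _ _ _)).
  have := @sum_degree_neighbors R G u C3_free; rewrite -/T => -> ; lra.
(* Uses [y z = 1] at the outside vertex and [a * y w <= deg w] at its neighbours. *)
have degB z : B z -> a ^+ 2 <= \sum_(w | A w) (adj z w)%:R * deg w.
  move=> /andP[zu uz]; have az : a <= \sum_(w | A w) (adj z w)%:R * y w.
    have := sub z; rewrite yB // mulr1 => /le_trans; apply.
    rewrite (sum_neighborhood u) adj_sym (negPf uz) mul0r add0r.
    rewrite [X in _ + X]big1 ?addr0 // => x /andP[xu ux].
    by rewrite (negPf (indepB _ _ _ _ _ _)) // mul0r.
  apply: le_trans (ler_wpM2l a_ge0 az) _; rewrite mulr_sumr.
  apply: ler_sum => w _; rewrite mulrCA; apply: ler_wpM2l => //.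
  apply: le_trans (sub w) _; apply: ler_sum => x _.
  by apply: ler_piMr => //; case/andP: (y01 x).
(* An outside vertex misses the matched vertices, each of degree at least 2 through [u] and its
   partner. So [a^2 <= a^2 + T / 2 - 2 T]: triangles at [u] and outside vertices exclude each
   other. *)
have T0 z : B z -> T = 0.
  move=> Bz; have /andP[zu uz] := Bz; apply/eqP; rewrite eq_le T_ge0 andbT.
  have : \sum_(w | A w) (adj z w)%:R * deg w <= \sum_(w | A w) (deg w - 2 * t w).
    apply: ler_sum => w uw; rewrite /t.
    have [/existsP[x /andP[ux xw]]|_] := boolP (in_triangle u w); last first.
      by rewrite mulr0 subr0 ler_piMl ?(ltW (deg_gt0 _)) // lern1 leq_b1.
    have -> : adj z w = false.
      apply: contraTF (introT existsP (ex_intro _ x (introT andP (conj ux xw)))).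
      by rewrite adj_sym; exact: triB.
    rewrite mul0r mulr1 subr_ge0 /deg (bigD1 u) //= adj_sym -/(A w) uw (bigD1 x) /=.
      by rewrite adj_sym xw addrA lerDl sumr_ge0.
    by apply: contraTneq ux => ->; rewrite adj_irr.
  rewrite sumrB -mulr_sumr sum_deg -/T; have := degB z Bz; lra.
have [/existsP[w0 /andP[uw0 tw0]]|noT] := boolP [exists w, A w && in_triangle u w].
  right; have T_neq0 : T != 0.
    apply: contraTneq tw0 => /(psumr_eq0P (fun _ _ => t_ge0 _)) => T0'.
    by have /eqP := T0' w0 uw0; rewrite pnatr_eq0 eqb0.
  have u_dom z : z != u -> adj u z.
    move=> zu; apply: contraNT T_neq0 => uz; apply/eqP/(T0 z); exact/andP.
  have [k [lt_k iso_k sum_k]] := isomorphic_Splus C3_free u_dom.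
  have k_gt0 : (0 < k)%N.
    have [x /andP[ux xw0]] := existsP tw0.
    have neq_u v : A v -> v != u by apply: contraTneq => ->; rewrite /A adj_irr.
    rewrite -(ltn_pmul2l (isT : 0 < 2)%N) -sum_k (bigD1 x) ?neq_u //=.
    by rewrite (bigD1 w0) ?neq_u //= xw0.
  have a3 : a = 3.
    by case: triA => // /(_ w0 uw0); rewrite tw0.
  have m9 : #|edges G| = 9.
    by apply/eqP; rewrite -(@eqr_nat R) mE a3; apply/eqP; ring.
  have : (2 * #|edges G| = 2 * #|G|.-1 + 2 * k)%N.
    apply/eqP; rewrite -(@eqr_nat R) -sum_adj_edges natrD -sum_k !natr_sum.
    under eq_bigr do rewrite natr_sum.
    under [X in _ == _ + X]eq_bigr do rewrite natr_sum.
    rewrite (sum_degreeD1 _ u) natrM; apply/eqP; congr (_ * _ + _).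
    rewrite -sum_adj_sym -(cardC1 u) -sum1_card natr_sum.
    by apply: eq_bigr => x xu; rewrite adj_sym u_dom.
  rewrite m9 => card_G.
  (* Counting edges gives [9 = (#|G| - 1) + k], and [2 k < #|G|] leaves [k <= 3]. *)
  have := iso_k; have [[k1 n1]|[[k2 n2]|[k3 n3]]] :
      (k = 1 /\ #|G| = 9 \/ k = 2 /\ #|G| = 8 \/ k = 3 /\ #|G| = 7)%N by lia.
  - by rewrite n1 k1; right; right.
  - by rewrite n2 k2; right; left.
  - by rewrite n3 k3; left.
left.
have T_eq0 : T = 0.
  apply: big1 => w uw; apply/eqP; rewrite pnatr_eq0 eqb0.
  by have := existsPn noT w; rewrite uw.
(* The degrees over [N(u)] now sum to exactly [a^2], so by [degB] an outside vertex cannot afford to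
   miss any [w], whose degree is positive. *)
have complete z w : B z -> A w -> adj z w.
  move=> Bz uw; apply: contraTT (degB z Bz) => zw; rewrite -ltNge.
  have -> : a ^+ 2 = \sum_(w | A w) deg w by rewrite sum_deg T_eq0; lra.
  rewrite (bigD1 w) //= [ltRHS](bigD1 w) //= (negPf zw) mul0r.
  apply: ltr_leD => //; apply: ler_sum => x _.
  by rewrite ler_piMl ?(ltW (deg_gt0 _)) // lern1 leq_b1.
pose X := [set w | adj u w]%SET.
exists #|X|, #|finset.setC X|; split.
- by have [x ux] := G_noiso u; apply/card_gt0P; exists x; rewrite inE.
- by apply/card_gt0P; exists u; rewrite !inE adj_irr.
apply: isomorphic_Kbip => x z; rewrite !inE.
have adjAB w v : A w -> ~~ A v -> adj w v.
  move=> uw uv; rewrite adj_sym; have [->//|vu] := eqVneq v u.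
  by apply: complete; rewrite /B ?vu.
have adjAA w v : A w -> A v -> ~~ adj w v.
  move=> uw uv; have := existsPn noT v; rewrite uv /=; apply: contra => wv.
  by apply/existsP; exists w; rewrite wv andbT.
have adjBB w v : ~~ A w -> ~~ A v -> ~~ adj w v.
  move=> uw uv; have [->//|wu] := eqVneq w u.
  have [->|vu] := eqVneq v u; first by rewrite adj_sym.
  exact: indepB.
have [ux|ux] := boolP (adj u x); have [uz|uz] := boolP (adj u z) => /=.
- exact/negbTE/adjAA.
- exact: adjAB.
- by rewrite adj_sym; exact: adjAB.
- exact/negbTE/adjBB.
Qed.

(** * Edge counts and eigenvectors of the extremal graphs *)

Lemma isomorphic_card_edges (G H : sgraph) :
  isomorphic G H -> #|edges G| = #|edges H|.
Proof.
move=> [f f_bij adjf]; apply/eqP; rewrite -(eqn_pmul2l (isT : 0 < 2)%N).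
rewrite -!sum_adj_edges (reindex f) /=; last exact/onW_bij.
apply/eqP/eq_bigr => x _; rewrite (reindex f) /=; last exact/onW_bij.
by apply: eq_bigr => z _; rewrite adjf.
Qed.

Lemma isomorphic_eigenvalue (R : realType) (G H : sgraph) (a : R)
    (y : H -> R) (i0 : H) :
  isomorphic G H -> y i0 != 0 ->
  (forall i, \sum_j (adj i j)%:R * y j = a * y i) ->
  eigenvalue (adjacency R G) a.
Proof.
move=> [f f_bij adjf] y0 yE; have [g fK gK] := f_bij.
apply: (@eigenvalue_adjacency _ _ _ (y \o f) (g i0)) => [|x].
  by rewrite /= gK.
rewrite /= -yE [RHS](reindex f) /=; last exact/onW_bij.
by apply: eq_bigr => z _; rewrite adjf.
Qed.

Lemma card_edges_Kbip (s t : nat) : #|edges (Kbip s t)| = (s * t)%N.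
Proof.
apply/eqP; rewrite -(eqn_pmul2l (isT : 0 < 2)%N) -sum_adj_edges big_sumType /=.
have -> : (\sum_(i < s) \sum_(z : Kbip s t) adj (inl i : Kbip s t) z = s * t)%N.
  rewrite -[s in RHS]card_ord -sum_nat_const; apply: eq_bigr => i _.
  by rewrite big_sumType /= big1 // add0n sum1_card card_ord.
have -> : (\sum_(j < t) \sum_(z : Kbip s t) adj (inr j : Kbip s t) z = s * t)%N.
  rewrite mulnC -[t in RHS]card_ord -sum_nat_const; apply: eq_bigr => i _.
  by rewrite big_sumType /= [X in (_ + X)%N]big1 // addn0 sum1_card card_ord.
by rewrite mul2n addnn.
Qed.

Lemma eigenvalue_Kbip (R : realType) (G : sgraph) (s t : nat) :
  (0 < s)%N -> (0 < t)%N -> isomorphic G (Kbip s t) ->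
  eigenvalue (adjacency R G) (Num.sqrt #|edges G|%:R).
Proof.
move=> s_gt0 t_gt0 isoG.
rewrite (isomorphic_card_edges isoG) card_edges_Kbip natrM sqrtrM ?ler0n //.
(* Each side carries the square root of the size of the other, so that
   [t sqrt s = sqrt (s t) sqrt t], and symmetrically. *)
pose y (x : Kbip s t) : R :=
  if x is inl _ then Num.sqrt t%:R else Num.sqrt s%:R.
apply: (@isomorphic_eigenvalue _ _ _ _ y (inl (Ordinal s_gt0)) isoG).
  by rewrite /= sqrtr_eq0 -ltNge ltr0n.
have sum_const n (b : R) : \sum_(i < n) 1 * b = Num.sqrt n%:R * Num.sqrt n%:R * b.
  by rewrite -expr2 sqr_sqrtr ?ler0n // sumr_const card_ord mul1r mulr_natl.
move=> [i|i]; rewrite big_sumType /=.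
  by rewrite big1 => [|? _]; rewrite ?mul0r // sum_const add0r; ring.
by rewrite [X in _ + X]big1 => [|? _]; rewrite ?mul0r // sum_const addr0; ring.
Qed.

(* The eigenvector of [S_7^3], [S_8^2] and [S_9^1] for the eigenvalue 3. *)
Definition Splus_weight (n k : nat) (i : 'I_n) : nat :=
  if val i == 0 then 6 else if (i.-1./2 < k)%N then 3 else 2.

(** The weights satisfy the equation at every leaf, as [6 + 3 = 3 * 3] and [6 = 3 * 2]; for [S_n^k]
    the equation at the centre amounts to [(n - 1) + k = 9]. *)
Lemma eigenvalue_Splus (R : realType) (G : sgraph) :
  isomorphic G (Splus 7 3) \/ isomorphic G (Splus 8 2) \/
  isomorphic G (Splus 9 1) -> eigenvalue (adjacency R G) 3.
Proof.
have weight n k : isomorphic G (Splus n.+1 k) ->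
    (forall i : 'I_n.+1, \sum_(j < n.+1) Splus_adj k i j * Splus_weight k j
      = 3 * Splus_weight k i)%N ->
    eigenvalue (adjacency R G) 3.
  move=> isoG wE.
  apply: (@isomorphic_eigenvalue _ _ _ _
    (fun j : Splus n.+1 k => (Splus_weight k j)%:R) ord0 isoG).
    by rewrite pnatr_eq0.
  move=> i; rewrite -natrM -wE natr_sum.
  by apply: eq_bigr => j _; rewrite natrM.
by move=> [|[]] /weight; apply;
  case=> [[|[|[|[|[|[|[|[|[|i]]]]]]]]] //= lt_i]; rewrite !big_ord_recl big_ord0.
Qed.

Lemma card_edges_Splus (G : sgraph) :
  isomorphic G (Splus 7 3) \/ isomorphic G (Splus 8 2) \/
  isomorphic G (Splus 9 1) -> #|edges G| = 9.
Proof.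
have half n k : (\sum_(i < n) \sum_(j < n) Splus_adj k i j = 18)%N ->
    #|edges (Splus n k)| = 9.
  by move=> S18; have := sum_adj_edges (Splus n k); rewrite /= S18; lia.
by move=> [|[]] /isomorphic_card_edges ->; apply: half;
  rewrite !big_ord_recl !big_ord0.
Qed.

(** * From subeigenvectors back to the spectral radius *)

Lemma spectral_radius_le_sqrt (R : realType) (G : sgraph) :
  (forall (a : R) (y : G -> R) u, subeigen a y u -> 0 <= a ->
    #|edges G|%:R <= a ^+ 2 ->
    a ^+ 2 <= #|edges G|%:R) ->
  spectral_radius R G <= Num.sqrt #|edges G|%:R.
Proof.
move=> bound; apply: spectral_radius_le; first exact: sqrtr_ge0.
(* An eigenvalue above [sqrt m] is nonnegative with [m < a^2], so it falls in the range covered by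
   [bound], which it contradicts. *)
move=> a /eigenvalue_subeigen[y [u ysub]]; rewrite leNgt; apply/negP => lt_ma.
have a_ge0 : 0 <= a by apply: le_trans (ltW lt_ma); exact: sqrtr_ge0.
have lt_m_a2 : #|edges G|%:R < a ^+ 2.
  by rewrite -[ltLHS]sqr_sqrtr ?ler0n // ltr_pXn2r ?nnegrE ?sqrtr_ge0.
by have := bound a y u ysub a_ge0 (ltW lt_m_a2); rewrite leNgt lt_m_a2.
Qed.

(** With an edge present the radius is nonzero, hence a genuine eigenvalue rather than the default
    of [sup]. *)
Lemma spectral_radius_eq_sqrt (R : realType) (G : sgraph) :
  (0 < #|edges G|)%N ->
  spectral_radius R G = Num.sqrt #|edges G|%:R ->
  exists (y : G -> R) u, subeigen (Num.sqrt #|edges G|%:R : R) y u.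
Proof.
move=> m_gt0 srE; apply: eigenvalue_subeigen; rewrite -srE.
by apply: spectral_radius_eigenvalue; rewrite srE sqrtr_eq0 -ltNge ltr0n.
Qed.

(** A vertex other than [u] has some neighbour, which can only be [u]. *)
Lemma isomorphic_star (G : sgraph) (u : G) :
  no_isolated G -> (forall x z, x != u -> z != u -> ~~ adj x z) ->
  isomorphic G (Kbip 1 #|edges G|).
Proof.
move=> G_noiso off_u.
have isoG : isomorphic G (Kbip #|[set u]%SET| #|finset.setC [set u]%SET|).
  apply: isomorphic_Kbip => x z; rewrite !inE.
  have u_dom v : v != u -> adj v u.
    move=> vu; have [w vw] := G_noiso v; suff <- : w = u by [].
    by apply: contraTeq vw; exact: off_u.
  have [->|xu] := eqVneq x u; have [->|zu] := eqVneq z u => /=.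
  - exact: adj_irr.
  - by rewrite adj_sym u_dom.
  - exact: u_dom.
  - exact/negbTE/off_u.
have := isomorphic_card_edges isoG; rewrite card_edges_Kbip cards1 mul1n => ->.
by move: isoG; rewrite cards1.
Qed.

Theorem theorem1p3 (R : realType) (m : nat) (G : sgraph)
    (m_gt0 : (0 < m)%N) (sizeG : #|edges G| = m) (G_noiso : no_isolated G) :
  (forall r : nat, (2 <= r)%N -> (16 * r ^ 2 <= m)%N ->
     ~ contains G (Kbip 2 r.+1) ->
     spectral_radius R G <= Num.sqrt (m%:R : R) /\
     (spectral_radius R G = Num.sqrt (m%:R : R) <-> isomorphic G (Kbip 1 m)))
  /\
  ((9 <= m)%N -> ~ contains G (Cplus 3) -> ~ contains G (Cplus 4) ->
     spectral_radius R G <= Num.sqrt (m%:R : R) /\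
     (spectral_radius R G = Num.sqrt (m%:R : R) <->
        complete_bipartite G \/ isomorphic G (Splus 7 3) \/
        isomorphic G (Splus 8 2) \/ isomorphic G (Splus 9 1))).
Proof.
have sqrt_sqr : Num.sqrt (m%:R : R) ^+ 2 = m%:R by rewrite sqr_sqrtr ?ler0n.
split=> [r r_ge2 m_ge G_free|m_ge9 C3_free C4_free]; subst m.
  have le_sr : spectral_radius R G <= Num.sqrt #|edges G|%:R.
    apply: spectral_radius_le_sqrt => a y u ysub a_ge0 le_ma.
    by have [] := K2_free_subeigen r_ge2 m_ge G_free ysub a_ge0 le_ma.
  split=> //; split=> [|isoG].
    case/(spectral_radius_eq_sqrt m_gt0) => y [u ysub].
    apply: (isomorphic_star (u := u)) => //.
    have [] // := K2_free_subeigen r_ge2 m_ge G_free ysub (sqrtr_ge0 _) _.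
    by rewrite sqrt_sqr.
  apply/eqP; rewrite eq_le le_sr; apply: eigenvalue_le_spectral_radius.
  exact: eigenvalue_Kbip isoG.
(* This is where [m >= 9] enters (ii). *)
have a_ge3 (a : R) : 0 <= a -> #|edges G|%:R <= a ^+ 2 -> 3 <= a.
  move=> a_ge0 le_ma; rewrite -(@ler_pXn2r _ 2) ?nnegrE //.
  by apply: le_trans le_ma; rewrite -natrX ler_nat.
have le_sr : spectral_radius R G <= Num.sqrt #|edges G|%:R.
  apply: spectral_radius_le_sqrt => a y u ysub a_ge0 le_ma.
  have ge3 := a_ge3 a a_ge0 le_ma.
  by have [] := house_free_subeigen G_noiso C3_free C4_free ysub ge3 le_ma.
split=> //; split=> [|extremal].
  case/(spectral_radius_eq_sqrt m_gt0) => y [u ysub].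
  apply: (house_free_extremal G_noiso C3_free C4_free ysub).
    by apply: a_ge3; rewrite ?sqrtr_ge0 // sqrt_sqr.
  by rewrite sqrt_sqr.
apply/eqP; rewrite eq_le le_sr; apply: eigenvalue_le_spectral_radius.
case: extremal => [[s [t [s_gt0 t_gt0 isoG]]]|isoS].
  exact: eigenvalue_Kbip isoG.
rewrite (card_edges_Splus isoS).
have -> : Num.sqrt 9%:R = 3 :> R.
  by rewrite -[9%N]/(3 ^ 2)%N natrX sqrtr_sqr ger0_norm.
exact: eigenvalue_Splus.
Qed.
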